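(* Let $0\le \delta<\rho\le 1$. Let $(m_j)_{j\in\mathbb{N}_0}$ be a strictly decreasing sequence of real numbers with $m_j\to-\infty$ as $j\to\infty$, and let $(\sigma_j)_{j\in\mathbb{N}_0}$ be a sequence of symbols with $\sigma_j\in S^{m_j}_{\rho,\delta}(\mathbb{Z}_p\times\widehat{\mathbb{Z}}_p)$ for every $j$. Then there exists a symbol $\sigma\in S^{m_0}_{\rho,\delta}(\mathbb{Z}_p\times\widehat{\mathbb{Z}}_p)$ such that for all $N\in\mathbb{N}_0$ $$\sigma-\sum_{j=0}^{N-1}\sigma_j\in S^{m_N}_{\rho,\delta}(\mathbb{Z}_p\times\widehat{\mathbb{Z}}_p).$$
   Context: Let $p$ be a fixed prime, $\mathbb{N}_0=\{0,1,2,\dots\}$, $\mathbb{Z}_p$ the compact group of $p$-adic integers with normalised Haar measure $dx$, and $\widehat{\mathbb{Z}}_p\cong\mathbb{Q}_p/\mathbb{Z}_p$ its dual group. For $\xi\in\widehat{\mathbb{Z}}_p$, $\xi\neq0$, $|\xi|_p$ is the $p$-adic absolute value of any representative (it is a positive power of $p$); $|0|_p:=0$. Put $\langle\xi\rangle:=\max\{1,|\xi|_p\}$, $\chi_p(\xi x):=e^{2\pi i\{\xi x\}_p}$ (with $\{\cdot\}_p$ the $p$-adic fractional part), $\widehat f(\xi):=\int_{\mathbb{Z}_p}f(x)\overline{\chi_p(\xi x)}\,dx$. The Vladimirov operator $D^\beta$, $\beta>0$, is the Fourier multiplier $$D^\beta f(x)=\sum_{\xi\in\widehat{\mathbb{Z}}_p}\Big(|\xi|_p^\beta+\frac{1-p^{-1}}{1-p^{-(\beta+1)}}(1-\delta_{\xi,0})\Big)\widehat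 f(\xi)\chi_p(\xi x)$$ ($\delta_{\xi,0}$ the Kronecker delta), and $D^0$ is the identity. $D_x^\beta$ means $D^\beta$ applied in the variable $x$. Symbol classes: a symbol is a function of the form $(x,\xi)\mapsto\sigma(x,|\xi|_p)$ where $\sigma(x,\cdot)$ is defined on all of $\mathbb{Z}$. The difference operator is $\Delta_\xi\sigma(x,|\xi|_p):=\sigma(x,|\xi|_p+1)-\sigma(x,|\xi|_p)$, i.e. $\Delta_\xi^\alpha\sigma(x,|\xi|_p)=(\Delta^\alpha\sigma(x,\cdot))(|\xi|_p)$ with $\Delta f(n)=f(n+1)-f(n)$ on $\mathbb{Z}$. For $m\in\mathbb{R}$ and $0\le\delta<\rho\le1$, $S^m_{\rho,\delta}(\mathbb{Z}_p\times\widehat{\mathbb{Z}}_p)$ is the set of such symbols for which, for all $\alpha,\beta\in\mathbb{N}_0$, there is a constant $C_{\sigma,m,\alpha,\beta}$ with $$|\Delta_\xi^\alpha D_x^\beta\sigma(x,|\xi|_p)|\le C_{\sigma,m,\alpha,\beta}\langle\xi\rangle^{m-\rho\alpha+\delta\beta}\quad\text{for all }(x,\xi)\in\mathbb{Z}_p\times\widehat{\mathbb{Z}}_p.$$ *)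

(* Defs.v *)
From HB Require Import structures.
From mathcomp Require Import all_boot all_order all_algebra finmap.
From mathcomp Require Import all_classical all_reals all_analysis.
From mathcomp.analysis Require showcase.summability.
From mathcomp Require Import complex.

Set Implicit Arguments.
Unset Strict Implicit.
Unset Printing Implicit Defensive.

Import Order.TTheory GRing.Theory Num.Theory.
Import numFieldNormedType.Exports.

Local Open Scope classical_set_scope.
Local Open Scope ring_scope.

(* The p-adic integers as the inverse limit of the rings Z/p^n: the component
   [zres x n] is the representative in [0, p^n) of x modulo p^n (the condition
   below already forces [zres x n < p ^ n]). The primality proof is a parameter
   of the type so that the ring instances can depend on it. *)
Record padicZ (p : nat) (p_pr : prime p) := MkPadicZ {
  zres : nat -> nat;
  zres_compat : forall n, (zres n.+1 %% p ^ n = zres n)%N }.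

Section ZpRing.
Local Open Scope nat_scope.
Variables (p : nat) (p_pr : prime p).
Local Notation padicZ := (padicZ p_pr).
Implicit Types x y z : padicZ.

HB.instance Definition _ := gen_eqMixin padicZ.
HB.instance Definition _ := gen_choiceMixin padicZ.

Lemma pX_gt0 n : 0 < p ^ n. Proof. by rewrite expn_gt0 prime_gt0. Qed.

Lemma zres_mod x n : zres x n %% p ^ n = zres x n.
Proof. by rewrite -(zres_compat x n) modn_mod. Qed.

Lemma modn_pXS a n : (a %% p ^ n.+1) %% p ^ n = a %% p ^ n.
Proof. by rewrite modn_dvdm// expnS dvdn_mull. Qed.

Lemma zres_le x n k : n <= k -> zres x k %% p ^ n = zres x n.
Proof.
elim: k => [|k IHk]; first by rewrite leqn0 => /eqP ->; exact: zres_mod.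
rewrite leq_eqVlt => /predU1P[->|]; first exact: zres_mod.
rewrite ltnS => nk; rewrite -(IHk nk) -(zres_compat x k).
by rewrite modn_dvdm// dvdn_exp2l.
Qed.

Lemma padicZ_ext x y : (forall n, zres x n = zres y n) -> x = y.
Proof.
case: x y => [f fP] [g gP] /= fg; have {}fg : f = g by exact/funext.
by subst g; congr MkPadicZ; exact: Prop_irrelevance.
Qed.

Lemma zp_nat_subproof (a : nat) n : (a %% p ^ n.+1) %% p ^ n = a %% p ^ n.
Proof. exact: modn_pXS. Qed.
Definition zp_nat a : padicZ := MkPadicZ p_pr (zp_nat_subproof a).

Lemma zp_add_subproof x y n :
  ((zres x n.+1 + zres y n.+1) %% p ^ n.+1) %% p ^ n
  = (zres x n + zres y n) %% p ^ n.
Proof. by rewrite modn_pXS -modnDm !zres_compat. Qed.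
Definition zp_add x y : padicZ := MkPadicZ p_pr (zp_add_subproof x y).

Lemma zp_opp_subproof x n :
  ((p ^ n.+1 - zres x n.+1) %% p ^ n.+1) %% p ^ n
  = (p ^ n - zres x n) %% p ^ n.
Proof.
have ltx k : zres x k <= p ^ k by rewrite -zres_mod ltnW// ltn_mod pX_gt0.
rewrite modn_pXS; apply/eqP; rewrite -(eqn_modDr (zres x n.+1)) subnK//.
rewrite -(modnDmr _ (zres x n.+1)) zres_compat subnK// modnn.
by rewrite expnS modnMl.
Qed.
Definition zp_opp x : padicZ := MkPadicZ p_pr (zp_opp_subproof x).

Lemma zp_mul_subproof x y n :
  ((zres x n.+1 * zres y n.+1) %% p ^ n.+1) %% p ^ n
  = (zres x n * zres y n) %% p ^ n.
Proof. by rewrite modn_pXS -modnMm !zres_compat. Qed.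
Definition zp_mul x y : padicZ := MkPadicZ p_pr (zp_mul_subproof x y).

Fact zp_addA : associative zp_add.
Proof. by move=> x y z; apply: padicZ_ext => n /=; rewrite modnDml modnDmr addnA. Qed.
Fact zp_addC : commutative zp_add.
Proof. by move=> x y; apply: padicZ_ext => n /=; rewrite addnC. Qed.
Fact zp_add0 : left_id (zp_nat 0) zp_add.
Proof. by move=> x; apply: padicZ_ext => n /=; rewrite mod0n add0n zres_mod. Qed.
Fact zp_addN : left_inverse (zp_nat 0) zp_opp zp_add.
Proof.
move=> x; apply: padicZ_ext => n /=.
by rewrite modnDml subnK ?modnn ?mod0n// -zres_mod ltnW// ltn_mod pX_gt0.
Qed.
HB.instance Definition _ :=
  GRing.isZmodule.Build padicZ zp_addA zp_addC zp_add0 zp_addN.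

Fact zp_mulA : associative zp_mul.
Proof. by move=> x y z; apply: padicZ_ext => n /=; rewrite modnMml modnMmr mulnA. Qed.
Fact zp_mulC : commutative zp_mul.
Proof. by move=> x y; apply: padicZ_ext => n /=; rewrite mulnC. Qed.
Fact zp_mul1 : left_id (zp_nat 1) zp_mul.
Proof. by move=> x; apply: padicZ_ext => n /=; rewrite modnMml mul1n zres_mod. Qed.
Fact zp_mulDl : left_distributive zp_mul zp_add.
Proof.
by move=> x y z; apply: padicZ_ext => n /=; rewrite modnMml modnDm mulnDl.
Qed.
Fact zp_1neq0 : zp_nat 1 != 0%R.
Proof.
apply/eqP => /(congr1 (fun x => zres x 1)) /=.
by rewrite mod0n expn1 modn_small// prime_gt1.
Qed.
HB.instance Definition _ := GRing.Zmodule_isComNzRing.Build padicZ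
  zp_mulA zp_mulC zp_mul1 zp_mulDl zp_1neq0.

Definition zp_unit : {pred padicZ} := fun x => `[< exists y, (y * x = 1)%R >].
Definition zp_inv x : padicZ :=
  if pselect (exists y, (y * x = 1)%R) is left h then projT1 (cid h) else x.

Fact zp_mulV : {in zp_unit, left_inverse 1%R zp_inv *%R}.
Proof.
move=> x /asboolP hx; rewrite /zp_inv; case: pselect => // h.
exact: projT2 (cid h).
Qed.
Fact zp_unitP x y : (y * x = 1)%R -> zp_unit x.
Proof. by move=> yx; apply/asboolP; exists y. Qed.
Fact zp_inv_out : {in [predC zp_unit], zp_inv =1 id}.
Proof.
move=> x; rewrite inE /= => /asboolPn hx.
by rewrite /zp_inv; case: pselect.
Qed.
HB.instance Definition _ := GRing.ComNzRing_hasMulInverse.Build padicZ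
  zp_mulV zp_unitP zp_inv_out.

Lemma zp_neq0 x : x != 0%R -> exists n, zres x n != 0.
Proof.
move=> /eqP x0; apply: contrapT => h; apply: x0; apply: padicZ_ext => n /=.
by rewrite mod0n; apply: contrapT => /eqP xn; apply: h; exists n.
Qed.

Fact zp_idomain x y : (x * y = 0)%R -> (x == 0%R) || (y == 0%R).
Proof.
move=> xy0; apply: contrapT => /negP; rewrite negb_or => /andP[].
move=> /zp_neq0[i xi] /zp_neq0[j yj].
have nd (w : padicZ) k : zres w k != 0 ->
    forall l, k <= l -> 0 < zres w l /\ logn p (zres w l) < k.
  move=> wk l kl; have : ~~ (p ^ k %| zres w l).
    by rewrite /dvdn zres_le.
  case: (posnP (zres w l)) => [->|w0]; first by rewrite dvdn0.
  by rewrite pfactor_dvdn// -ltnNge.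
have [x0 vx] := nd _ _ xi (i + j) (leq_addr _ _).
have [y0 vy] := nd _ _ yj (i + j) (leq_addl _ _).
have /(congr1 (fun z => zres z (i + j))) /= := xy0.
rewrite mod0n => /eqP; rewrite -/(dvdn _ _) pfactor_dvdn ?muln_gt0 ?x0//.
by rewrite lognM// leqNgt -addSn leq_add// ltnW.
Qed.
HB.instance Definition _ := GRing.ComUnitRing_isIntegral.Build padicZ zp_idomain.

End ZpRing.

(* Borel sigma-algebra: open sets are the unions of balls x + p^n Z_p. *)
Definition padicZ_open (p : nat) (p_pr : prime p) : set (set (padicZ p_pr)) :=
  [set A | forall x, A x ->
     exists n, forall y, zres y n = zres x n -> A y].

HB.instance Definition _ (p : nat) (p_pr : prime p) :=
  isPointed.Build (padicZ p_pr) 0.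
HB.instance Definition _ (p : nat) (p_pr : prime p) :=
  Measurable.copy (padicZ p_pr) (g_sigma_algebraType (@padicZ_open p p_pr)).

(* Together with [mu : probability (padicZ p_pr) R] (total mass 1), this
   characterizes the normalised Haar measure. *)
Definition is_haar (R : realType) (p : nat) (p_pr : prime p)
    (mu : set (padicZ p_pr) -> \bar R) :=
  forall (a : padicZ p_pr) (A : set (padicZ p_pr)), measurable A ->
    mu [set a + x | x in A] = mu A.

Section padicQ.
Variables (p : nat) (p_pr : prime p).

Definition padicQ : fieldType := {fraction (padicZ p_pr)}.

Definition padicQ_of (x : padicZ p_pr) : padicQ := FracField.tofrac x.

(* The p-adic order of q != 0: the k such that q = p^k u with u a unit of Z_p. *)
Definition padic_ord (q : padicQ) : int :=
  xget 0 [set k : int | exists2 u : padicZ p_pr,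
    u \is a GRing.unit & q = p%:R ^ k * padicQ_of u].

Definition padic_abs (q : padicQ) : rat :=
  if q == 0 then 0 else p%:R ^ (- padic_ord q).

(* The p-adic fractional part: the r in Z[1/p], 0 <= r < 1, with q - r in Z_p. *)
Definition padic_frac (q : padicQ) : rat :=
  xget 0 [set r : rat | [/\ 0 <= r < 1,
    exists n : nat, r * p%:R ^+ n \is a Num.int &
    exists x : padicZ p_pr, q - ratr r = padicQ_of x]].

Definition padicZ_in_padicQ : {pred padicQ} :=
  fun q => `[< exists x, q = padicQ_of x >].

Fact padicZ_in_padicQ_zmod_closed : zmod_closed padicZ_in_padicQ.
Proof.
split; first by apply/asboolP; exists 0; rewrite /padicQ_of rmorph0.
move=> _ _ /asboolP[x ->] /asboolP[y ->]; apply/asboolP; exists (x - y).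
by rewrite /padicQ_of rmorphB.
Qed.
HB.instance Definition _ :=
  GRing.isZmodClosed.Build padicQ padicZ_in_padicQ padicZ_in_padicQ_zmod_closed.

Definition padicZ_dual := Quotient.quot padicZ_in_padicQ.

(* For xi != 0 the representative lies outside Z_p, so that its absolute value
   is an integer, a positive power of p; the floor only changes the type. *)
Definition dual_abs (xi : padicZ_dual) : int :=
  if xi == 0 then 0 else Num.floor (padic_abs (generic_quotient.repr xi)).

Definition japanese (R : realType) (xi : padicZ_dual) : R :=
  Num.max 1 (dual_abs xi)%:~R.

Definition cexp_i (R : realType) (t : R) : R[i] := (cos t +i* sin t)%C.

(* The character x |-> chi_p (xi x). *)
Definition dual_char (R : realType) (xi : padicZ_dual) (x : padicZ p_pr) : R[i] :=
  cexp_i (2 * pi * ratr (padic_frac (generic_quotient.repr xi * padicQ_of x))).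

End padicQ.

Section Fourier.
Variables (R : realType) (p : nat) (p_pr : prime p).
Variable mu : probability (padicZ p_pr) R.
Implicit Types f : padicZ p_pr -> R[i].

Definition cintegrable f :=
  mu.-integrable setT (EFin \o (fun x => complex.Re (f x))) /\
  mu.-integrable setT (EFin \o (fun x => complex.Im (f x))).

Definition cintegral f : R[i] :=
  ((\int[mu]_x complex.Re (f x)) +i* (\int[mu]_x complex.Im (f x)))%C.

Definition fourier f (xi : padicZ_dual p_pr) : R[i] :=
  cintegral (fun x => f x * Num.conj (dual_char R xi x)).

Definition vladimirov_mult (b : R) (xi : padicZ_dual p_pr) : R :=
  (dual_abs xi)%:~R `^ b
  + (1 - p%:R^-1) / (1 - p%:R `^ (- (b + 1))) * (xi != 0)%:R.

Definition vladimirov_term (b : R) f (x : padicZ p_pr)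
    (xi : padicZ_dual p_pr) : R[i]^o :=
  (vladimirov_mult b xi)%:C%C * fourier f xi * dual_char R xi x.

(* The sum over the (discrete) dual group is the unordered one: the limit of the
   partial sums along the finite subsets of the dual group. *)
Definition vladimirov (b : R) f (x : padicZ p_pr) : R[i] :=
  if b == 0 then f x else summability.sum (vladimirov_term b f x).

(* f is in the domain of D^b, that is, D^b f is defined at every point. *)
Definition vladimirov_dom (b : R) f : Prop :=
  b != 0 -> cintegrable f /\
    forall x, cvg (summability.partial_sum (vladimirov_term b f x)
                     @ summability.totally).

Definition difference (g : int -> R[i]) (n : int) : R[i] := g (n + 1) - g n.

(* The values at integers that enter the estimates are those at |xi|_p + k with
   k a natural number, that is (take xi = 0) at all natural numbers; the
   functions D_x^b sigma(., n) must be defined there. *)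
Definition symbol_class (m rho delta : R) (sigma : padicZ p_pr -> int -> R[i]) :=
  (forall b n : nat, vladimirov_dom b%:R (fun x => sigma x n%:Z)) /\
  forall a b : nat, exists C : R, forall (x : padicZ p_pr) (xi : padicZ_dual p_pr),
    `| iter a difference (fun n => vladimirov b%:R (sigma ^~ n) x) (dual_abs xi) |
    <= (C * japanese R xi `^ (m - rho * a%:R + delta * b%:R))%:C%C.

End Fourier.

(* Main.v *)
(* The differences are taken forward from the points |xi|_p in {0} U {p^k}, so a
   sharp cutoff at a power of p is harmless: put
     sigma(x, n) = sum of the sigma_j(x, n) over the j with p^(K j) <= n.
   Once p^k > a, the points p^k, ..., p^k + a lie on the same side of every
   cutoff, hence Delta^a D^b commutes with the truncation at |xi|_p = p^k, and
   K j is chosen so large that, for |xi|_p >= p^(K j) and a, b <= j, the j-th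
   term is at most 2^-j <xi>^(m_(j-1) - rho a + delta b). The finitely many
   remaining frequencies are controlled by the estimates at xi = 0 for all a,
   which bound D^b sigma_j(., n) for every natural n. Applying D^b to the finite
   sums requires the characters to be measurable; they are locally constant. *)

Require Import Defs.
From HB Require Import structures.
From mathcomp Require Import generic_quotient.
From mathcomp Require Import all_boot all_order all_algebra finmap.
From mathcomp Require Import all_classical all_reals all_analysis.
From mathcomp.analysis Require showcase.summability.
From mathcomp Require Import complex.
From mathcomp Require Import ring cyclic.

Set Implicit Arguments.
Unset Strict Implicit.
Unset Printing Implicit Defensive.

Import Order.TTheory GRing.Theory Num.Theory.
Import numFieldNormedType.Exports.

Local Open Scope classical_set_scope.
Local Open Scope ring_scope.

(** * Denominators in the fraction field of [padicZ] *)

Lemma fraction_numden (D : idomainType) (q : {fraction D}) :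
  exists a b, b != 0 /\ q * FracField.tofrac b = FracField.tofrac a.
Proof.
elim/quotW: q => r; exists r.1, r.2; split; first exact: denom_ratioP.
unlock FracField.tofrac; rewrite -[LHS]FracField.pi_mul.
apply/eqmodP; rewrite /= FracField.equivfE.
by rewrite !numden_Ratio ?mulf_neq0 ?oner_neq0 ?denom_ratioP// !mulr1 mulrC.
Qed.

Lemma padicZ_natE (p : nat) (p_pr : prime p) k : k%:R = zp_nat p_pr k.
Proof.
elim: k => [//|k IHk]; rewrite -addn1 natrD IHk.
by apply: padicZ_ext => l; rewrite /= modnDm.
Qed.

(** Factor b = p^v u with u a unit: v is the valuation of a nonzero residue of b, and c is the
    inverse of u, built residue by residue from Euler's theorem. *)
Lemma padicZ_dvd_expp (p : nat) (p_pr : prime p) (b : padicZ p_pr) :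
  b != 0 -> exists n, exists c, b * c = p%:R ^+ n.
Proof.
move=> /zp_neq0[n bn0].
have ppos k : (0 < p ^ k)%N by rewrite expn_gt0 prime_gt0.
have bmod l : (zres b (l + n) = zres b n %[mod p ^ n])%N.
  by rewrite zres_mod zres_le// leq_addl.
set v := logn p (zres b n).
have vn : (v < n)%N.
  rewrite ltnNge; apply/negP => nv; move: bn0.
  rewrite -zres_mod; apply/negP; rewrite negbK; apply: dvdn_trans (dvdn_exp2l p nv) _.
  exact: pfactor_dvdnn.
have dvdb k l : (k <= n)%N -> (p ^ k %| zres b (l + n) = (p ^ k %| zres b n))%N.
  move=> kn; rewrite /dvdn -(modn_dvdm (zres b (l + n)) (dvdn_exp2l p kn)) bmod.
  by rewrite modn_dvdm// dvdn_exp2l.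
(* Dividing by p^v loses v digits; reading b at level l + n with v < n keeps u exact modulo p^l. *)
pose u l := (zres b (l + n) %/ p ^ v)%N.
have uE l : (zres b (l + n) = u l * p ^ v)%N.
  by rewrite divnK// dvdb ?pfactor_dvdnn// ltnW.
have ucop l : coprime (u l) (p ^ l).
  rewrite coprime_sym coprimeXl// prime_coprime//; apply/negP => pu.
  have : (p ^ v.+1 %| zres b (l + n))%N by rewrite uE expnS dvdn_mul.
  by rewrite dvdb// pfactor_dvdn ?lt0n// ltnn.
have uS l : (u l.+1 = u l %[mod p ^ l])%N.
  apply/eqP; rewrite -(eqn_pmul2r (ppos v)) !muln_modl// -expnD -!uE addSn.
  have lvn : (l + v <= l + n)%N by rewrite leq_add2l ltnW.
  rewrite -(zres_compat b (l + n)) modn_dvdm//; exact: dvdn_exp2l.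
(* Inverse of [u l] modulo p^l: u^phi(p^l) = 1 by Euler. *)
pose c l := (u l ^ (totient (p ^ l)).-1 %% p ^ l)%N.
have uc l : (u l * c l = 1 %[mod p ^ l])%N.
  rewrite modnMmr -expnS prednK ?totient_gt0//; exact: Euler_exp_totient.
have cP l : (c l.+1 %% p ^ l = c l)%N.
  have /eqP cS : (c l.+1 == c l %[mod p ^ l])%N.
    have ul : (u l * c l.+1 = 1 %[mod p ^ l])%N.
      rewrite -modnMml -uS modnMml.
      by rewrite -(modn_dvdm (u _ * _) (dvdn_exp2l p (leqnSn l))) uc modn_dvdm ?dvdn_exp2l.
    have E w : (w * (u l * c l) = w %[mod p ^ l])%N.
      by rewrite -modnMmr uc modnMmr muln1.
    by rewrite -(E (c l.+1)) mulnCA mulnA -modnMml ul modnMml mul1n.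
  by rewrite cS modn_mod.
exists v, (MkPadicZ p_pr cP); rewrite -natrX.
rewrite padicZ_natE; apply: padicZ_ext => l /=.
rewrite -(zres_le b (leq_addr n l)) modnMml uE mulnAC mulnC -modnMmr uc.
by rewrite modnMmr muln1.
Qed.

(** * Local constancy of the characters *)

Section DualCharacter.
Variables (p : nat) (p_pr : prime p).

(** Both fractional parts are chosen by [xget] from the same set of candidates r, so equality of the
    two sets suffices. *)
Lemma padic_frac_eq (q q' : padicQ p_pr) (z : padicZ p_pr) :
  q - q' = padicQ_of z -> padic_frac q = padic_frac q'.
Proof.
move=> qz; rewrite /padic_frac; congr xget; apply/seteqP.
split=> r [r01 rp [x xE]]; split=> //.
- exists (x - z); rewrite /padicQ_of rmorphB/= -!/(padicQ_of _) -xE -qz; ring.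
- exists (x + z); rewrite /padicQ_of rmorphD/= -!/(padicQ_of _) -xE -qz; ring.
Qed.

(** The quotient z is w with its n vanishing lowest digits removed: level l of z comes from level l
    + n of w. *)
Lemma zres0_dvd_expp (w : padicZ p_pr) n :
  zres w n = 0%N -> exists z, w = z * p%:R ^+ n.
Proof.
move=> wn0.
have dvdw l : (p ^ n %| zres w (l + n))%N.
  by rewrite /dvdn zres_le ?leq_addl// wn0.
have zP l : ((zres w (l.+1 + n) %/ p ^ n) %% p ^ l = zres w (l + n) %/ p ^ n)%N.
  apply/eqP; rewrite -(eqn_pmul2r (pX_gt0 p_pr n)) muln_modl !divnK// -expnD.
  by rewrite addSn zres_compat.
exists (MkPadicZ p_pr zP); apply: padicZ_ext => l.
by rewrite -natrX padicZ_natE/= modnMmr divnK// zres_le ?leq_addr.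
Qed.

Lemma padicQ_ofM : {morph @padicQ_of p p_pr : x y / x * y}.
Proof. exact: tofracM. Qed.

Lemma padicQ_ofB : {morph @padicQ_of p p_pr : x y / x - y}.
Proof. exact: rmorphB. Qed.

(* For q = a / b and b c = p^n, the product q x changes by a p-adic integer
   when x changes by a multiple of p^n. *)
Lemma padic_frac_loc_cst (q : padicQ p_pr) : exists n, forall x y,
  zres y n = zres x n ->
  padic_frac (q * padicQ_of y) = padic_frac (q * padicQ_of x).
Proof.
have [a [b [b0 qba]]] := fraction_numden q.
have [n [c bc]] := padicZ_dvd_expp b0; exists n => x y xyn.
have /zres0_dvd_expp[z yxz] : zres (y - x) n = 0%N.
  rewrite /= modnDmr xyn; have := zp_addN x => /(congr1 (fun z => zres z n)) /=.
  by rewrite mod0n modnDml addnC.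
apply: (@padic_frac_eq _ _ (z * (a * c))).
rewrite -mulrBr -padicQ_ofB yxz -bc !padicQ_ofM mulrCA; congr (_ * _).
by rewrite mulrA qba.
Qed.
End DualCharacter.

(* Measurability of characters; linearity of the Fourier transform and of D^b *)
#[local] Existing Instance summability.totally_filter.

(** The preimage of any set is a union of balls of level n, hence open and a generator of the
    sigma-algebra. *)
Lemma measurable_loc_cst (p : nat) (p_pr : prime p) (R : realType)
    (h : padicZ p_pr -> R) n :
  (forall x y, zres y n = zres x n -> h y = h x) -> measurable_fun setT h.
Proof.
move=> hn _ Y _; rewrite setTI; apply: sub_sigma_algebra => x /= Yhx.
by exists n => y /hn; rewrite /= => ->.
Qed.

Section FourierLinearity.
Variables (R : realType) (p : nat) (p_pr : prime p).
Variable mu : probability (padicZ p_pr) R.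
Implicit Types f g : padicZ p_pr -> R[i].

Lemma RintegrableMr (f1 h : padicZ p_pr -> R) :
  measurable_fun setT h -> (forall x, `|h x| <= 1) ->
  mu.-integrable setT (EFin \o f1) ->
  mu.-integrable setT (EFin \o (fun x => f1 x * h x)).
Proof.
move=> mh h1 if1.
have -> : EFin \o (fun x => f1 x * h x) = ((EFin \o f1) \* (EFin \o h))%E.
  by apply/funext => x /=; rewrite EFinM.
apply: integrableMl => //; exists 1; split => // M M1 x _.
exact: le_trans (h1 x) (ltW M1).
Qed.

Lemma RintegrableD (f1 f2 : padicZ p_pr -> R) :
  mu.-integrable setT (EFin \o f1) -> mu.-integrable setT (EFin \o f2) ->
  mu.-integrable setT (EFin \o (fun x => f1 x + f2 x)).
Proof.
move=> if1 if2; rewrite (_ : _ \o _ = (EFin \o f1) \+ (EFin \o f2))%E.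
  exact: integrableD.
by apply/funext => x /=; rewrite EFinD.
Qed.

Lemma RintegrableB (f1 f2 : padicZ p_pr -> R) :
  mu.-integrable setT (EFin \o f1) -> mu.-integrable setT (EFin \o f2) ->
  mu.-integrable setT (EFin \o (fun x => f1 x - f2 x)).
Proof.
move=> if1 if2; rewrite (_ : _ \o _ = (EFin \o f1) \- (EFin \o f2))%E.
  exact: integrableB.
by apply/funext => x /=; rewrite EFinB.
Qed.

(** The real and imaginary parts of the product combine those of f with cosine and sine factors,
    which are bounded by 1 and locally constant, hence measurable. *)
Lemma cintegrable_char f (xi : padicZ_dual p_pr) :
  cintegrable mu f -> cintegrable mu (fun x => f x * Num.conj (dual_char R xi x)).
Proof.
case=> reI imI.
have [n loc] := padic_frac_loc_cst (generic_quotient.repr xi).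
pose t x : R := 2 * pi * ratr (padic_frac (repr xi * padicQ_of x)).
have cm : measurable_fun setT (cos \o t).
  by apply: (@measurable_loc_cst _ _ _ _ n) => x y /loc; rewrite /t/= => ->.
have sm : measurable_fun setT (sin \o t).
  by apply: (@measurable_loc_cst _ _ _ _ n) => x y /loc; rewrite /t/= => ->.
have c1 x : `|(cos \o t) x| <= 1 by rewrite ler_norml cos_geN1 cos_le1.
have s1 x : `|(sin \o t) x| <= 1 by rewrite ler_norml sin_geN1 sin_le1.
split.
- have -> : (fun x => complex.Re (f x * Num.conj (dual_char R xi x))) =
      (fun x => complex.Re (f x) * (cos \o t) x + complex.Im (f x) * (sin \o t) x).
    by apply/funext => x; case: (f x) => a b /=; rewrite mulrN opprK.
  by apply: RintegrableD; exact: RintegrableMr.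
- have -> : (fun x => complex.Im (f x * Num.conj (dual_char R xi x))) =
      (fun x => complex.Im (f x) * (cos \o t) x - complex.Re (f x) * (sin \o t) x).
    by apply/funext => x; case: (f x) => a b /=; rewrite mulrN addrC.
  by apply: RintegrableB; exact: RintegrableMr.
Qed.

Lemma cintegrableB f g : cintegrable mu f -> cintegrable mu g ->
  cintegrable mu (fun x => f x - g x).
Proof.
move=> [fr fi] [gr gi]; split.
- under [fun x => complex.Re _]funext do rewrite raddfB/=.
  exact: RintegrableB.
- under [fun x => complex.Im _]funext do rewrite raddfB/=.
  exact: RintegrableB.
Qed.

Lemma cintegralB f g : cintegrable mu f -> cintegrable mu g ->
  cintegral mu (fun x => f x - g x) = cintegral mu f - cintegral mu g.
Proof.
move=> [fr fi] [gr gi]; rewrite /cintegral.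
under [in LHS]eq_Rintegral do rewrite raddfB/=.
under [X in (_ +i* X)%C = _]eq_Rintegral do rewrite raddfB/=.
by rewrite !RintegralB.
Qed.

Lemma fourierB f g xi : cintegrable mu f -> cintegrable mu g ->
  fourier mu (fun x => f x - g x) xi = fourier mu f xi - fourier mu g xi.
Proof.
move=> fI gI; rewrite /fourier -cintegralB; [|exact: cintegrable_char..].
by congr cintegral; apply/funext => x; rewrite mulrBl.
Qed.

Lemma vladimirov_partial_sumB b f g x : cintegrable mu f -> cintegrable mu g ->
  summability.partial_sum (vladimirov_term mu b (fun y => f y - g y) x) =
  summability.partial_sum (vladimirov_term mu b f x) -
  summability.partial_sum (vladimirov_term mu b g x).
Proof.
move=> fI gI; apply/funext => A.
rewrite /summability.partial_sum/= -[RHS]sumrB; apply: eq_bigr => i _.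
by rewrite /vladimirov_term fourierB// mulrBr mulrBl.
Qed.

Lemma vladimirov_domB b f g :
  vladimirov_dom mu b f -> vladimirov_dom mu b g ->
  vladimirov_dom mu b (fun x => f x - g x).
Proof.
move=> fD gD b0; have [fI fc] := fD b0; have [gI gc] := gD b0.
split=> [|x]; first exact: cintegrableB.
by rewrite vladimirov_partial_sumB//; apply: is_cvgB; [exact: fc|exact: gc].
Qed.

Lemma vladimirovB b f g x :
  vladimirov_dom mu b f -> vladimirov_dom mu b g ->
  vladimirov mu b (fun x => f x - g x) x = vladimirov mu b f x - vladimirov mu b g x.
Proof.
rewrite /vladimirov /vladimirov_dom; case: eqP => // _ fD gD.
have [fI fc] := fD isT; have [gI gc] := gD isT.
rewrite /summability.sum vladimirov_partial_sumB//.
by rewrite limB.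
Qed.

Lemma cintegrable0 : cintegrable mu (fun=> 0).
Proof. by split; exact: integrable0. Qed.

Lemma vladimirov_partial_sum0 b x :
  summability.partial_sum (vladimirov_term mu b (fun=> 0) x) = cst 0.
Proof.
(* Writing 0 as 0 - 0 turns the partial sum into a difference of equal terms, without computing any
   integral. *)
have E : (fun=> 0) = (fun x : padicZ p_pr => 0 - 0 :> R[i]).
  by rewrite subr0.
by rewrite {1}E vladimirov_partial_sumB ?subrr//; exact: cintegrable0.
Qed.

Lemma vladimirov_dom0 b : vladimirov_dom mu b (fun=> 0).
Proof.
move=> _; split=> [|x]; first exact: cintegrable0.
by rewrite vladimirov_partial_sum0; exact: is_cvg_cst.
Qed.

Lemma vladimirov0 b x : vladimirov mu b (fun=> 0) x = 0.
Proof.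
have := vladimirovB x (@vladimirov_dom0 b) (@vladimirov_dom0 b).
by rewrite subr0 subrr.
Qed.

Lemma vladimirov_sum b (I : Type) (r : seq I) (P : pred I)
    (F : I -> padicZ p_pr -> R[i]) :
  (forall i, vladimirov_dom mu b (F i)) ->
  vladimirov_dom mu b (fun x => \sum_(i <- r | P i) F i x) /\
  forall x, vladimirov mu b (fun x => \sum_(i <- r | P i) F i x) x =
    \sum_(i <- r | P i) vladimirov mu b (F i) x.
Proof.
move=> FD.
(* Additivity follows from the subtraction lemmas through f + g = f - (0 - g). *)
have D (f g : padicZ p_pr -> R[i]) :
    vladimirov_dom mu b f -> vladimirov_dom mu b g ->
    vladimirov_dom mu b (fun x => f x + g x) /\
    forall x, vladimirov mu b (fun x => f x + g x) x =
      vladimirov mu b f x + vladimirov mu b g x.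
  move=> fD gD; have D0 := @vladimirov_dom0 b.
  have -> : (fun x => f x + g x) = (fun x => f x - (0 - g x)).
    by apply/funext => x; rewrite sub0r opprK.
  have gN := vladimirov_domB D0 gD; split=> [|x]; first exact: (vladimirov_domB fD gN).
  by rewrite (vladimirovB x fD gN) (vladimirovB x D0 gD) vladimirov0 sub0r opprK.
elim: r => [|i r [IHd IHv]].
  have -> : (fun x => \sum_(i <- [::] | P i) F i x) = fun=> 0.
    by apply/funext => x; rewrite big_nil.
  split=> [|x]; first exact: vladimirov_dom0.
  by rewrite vladimirov0 big_nil.
have [Dd Dv] := D _ _ (FD i) IHd.
have E x : \sum_(i <- i :: r | P i) F i x =
  if P i then F i x + \sum_(i <- r | P i) F i x else \sum_(i <- r | P i) F i x.
  exact: big_cons.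
rewrite (funext E); case Pi: (P i); split.
- exact: Dd.
- by move=> x; rewrite Dv IHv big_cons Pi.
- exact: IHd.
- by move=> x; rewrite IHv big_cons Pi.
Qed.
End FourierLinearity.

(** * Iterated forward differences *)

Section Differences.
Variable R : realType.
Implicit Types g h : int -> R[i].

Local Notation normc := (@Normc.normc R).

Lemma normc_le (z : R[i]) (r : R) : (`|z| <= r%:C%C) = (normc z <= r).
Proof. by rewrite -lecR. Qed.

Lemma normc_sum (I : Type) (r : seq I) (P : pred I) (F : I -> R[i]) :
  normc (\sum_(i <- r | P i) F i) <= \sum_(i <- r | P i) normc (F i).
Proof.
by rewrite -lecR rmorph_sum/=; exact: (@ler_norm_sum _ R[i]).
Qed.

(** The a-th difference at n only sees n, ..., n + a; a cutoff that is constant on this window can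
    therefore be frozen. *)
Lemma iter_difference_eq a g h n :
  (forall i : nat, (i <= a)%N -> g (n + i%:Z) = h (n + i%:Z)) ->
  iter a (@difference R) g n = iter a (@difference R) h n.
Proof.
elim: a n => [|a IHa] n gh; first by have := gh 0%N isT; rewrite /= addr0.
rewrite !iterS /difference !IHa// => i ia; first exact/gh/leqW.
by have := gh i.+1 ia; rewrite -addn1 PoszD (addrC i%:Z) addrA.
Qed.

Lemma iter_difference_sum a (I : Type) (r : seq I) (P : pred I)
    (G : I -> int -> R[i]) n :
  iter a (@difference R) (fun n => \sum_(i <- r | P i) G i n) n =
  \sum_(i <- r | P i) iter a (@difference R) (G i) n.
Proof.
elim: a n => [//|a IHa] n; rewrite iterS /difference !IHa -sumrB.
by apply: eq_bigr => i _; rewrite iterS.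
Qed.

(** Each difference at most doubles the bound. *)
Lemma iter_difference_bound a g n (B : R) :
  (forall i : nat, (i <= a)%N -> normc (g (n + i%:Z)) <= B) ->
  normc (iter a (@difference R) g n) <= 2 ^+ a * B.
Proof.
elim: a n => [|a IHa] n gB.
  by have := gB 0%N isT; rewrite /= addr0 expr0 mul1r.
rewrite iterS /difference exprS -mulrA mulr_natl mulr2n.
apply: le_trans (le_normcD _ _) _; rewrite normcN lerD// IHa// => i ia.
  by have := gB i.+1 ia; rewrite -addn1 PoszD (addrC i%:Z) addrA.
exact/gB/leqW.
Qed.

(** Induction on n for all orders a at once, by Delta^a g(n+1) = Delta^(a+1) g(n) + Delta^a g(n). *)
Lemma iter_difference_nat_bound (T : Type) (g : T -> int -> R[i]) :
  (forall a, exists B, forall x, normc (iter a (@difference R) (g x) 0) <= B) ->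
  forall n : nat, exists B, forall x, normc (g x n%:Z) <= B.
Proof.
move=> g0 n.
suff : forall a, exists B,
    forall x, normc (iter a (@difference R) (g x) n%:Z) <= B.
  exact: (@^~ 0%N).
elim: n => [//|n IHn] a; have [B aB] := IHn a; have [B' aB'] := IHn a.+1.
exists (B' + B) => x; have := aB' x; rewrite iterS {1}/difference => h.
have -> : n.+1%:Z = n%:Z + 1 by rewrite -addn1 PoszD.
rewrite -(subrK (iter a (@difference R) (g x) n%:Z) (iter _ _ _ _)).
by apply: le_trans (le_normcD _ _) _; rewrite lerD.
Qed.
End Differences.

(** * Growth of powers and geometric tails *)

Section RealBounds.
Variable R : realType.

Lemma powR_ge_eventually (p : nat) (d M : R) : (1 < p)%N -> 0 < d ->
  exists K, forall k, (K <= k)%N -> M <= (p ^ k)%:R `^ d.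
Proof.
move=> p1 d0; have [M0|M0] := leP M 0.
  by exists 0%N => k _; exact: le_trans M0 (powR_ge0 _ _).
(* With this K, M^(1/d) < K <= k < p^k; then raise to the power d. *)
exists (Num.bound (M `^ d^-1)) => k Kk.
have -> : M = (M `^ d^-1) `^ d by rewrite -powRrM mulVf ?gt_eqF// powRr1// ltW.
apply: ge0_ler_powR; rewrite ?nnegrE ?powR_ge0// ?ltW//.
apply: lt_trans (archi_boundP (powR_ge0 _ _)) _.
by rewrite ltr_nat (leq_ltn_trans Kk)// ltn_expl.
Qed.

(** Supplies the constant for the truncated sum of symbols: the first J terms keep their own
    constants, the later ones have been made geometrically small. *)
Lemma sum_geometric_tail_bounded (J : nat) (c : nat -> R) :
  exists B, forall M,
    \sum_(0 <= j < M) (if (j < J)%N then `|c j| else 2^-1 ^+ j) <= B.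
Proof.
pose A j := if (j < J)%N then `|c j| else 2^-1 ^+ j : R.
have A0 j : 0 <= A j by rewrite /A; case: ifP => // _; rewrite exprn_ge0.
exists (\sum_(0 <= j < J) A j + 2) => M; rewrite -/A.
have geo L : \sum_(0 <= j < L) (2^-1 ^+ j : R) = 2 - 2 * 2^-1 ^+ L.
  elim: L => [|L IHL]; first by rewrite big_geq// expr0 mulr1 subrr.
  by rewrite big_nat_recr//= IHL exprS; field.
(* Lengthening the range to J + M makes the split at J valid for every M. *)
apply: (@le_trans _ _ (\sum_(0 <= j < J + M) A j)).
  rewrite [leRHS](@big_cat_nat _ _ _ M)//= ?leq_addl// lerDl.
  by rewrite sumr_ge0.
rewrite (@big_cat_nat _ _ _ J)//= ?leq_addr// lerD2l.
apply: (@le_trans _ _ (\sum_(J <= j < J + M) 2^-1 ^+ j)).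
  by apply: ler_sum_nat => j /andP[Jj _]; rewrite /A ltnNge Jj.
apply: (@le_trans _ _ (\sum_(0 <= j < J + M) 2^-1 ^+ j)).
  rewrite [leRHS](@big_cat_nat _ _ _ J)//= ?leq_addr// lerDr.
  by rewrite sumr_ge0// => j _; rewrite exprn_ge0.
by rewrite geo gerBl mulr_ge0// exprn_ge0.
Qed.
End RealBounds.

(** * Symbol classes and reduction to large frequencies *)

Section Symbols.
Variables (R : realType) (p : nat) (p_pr : prime p).
Variable mu : probability (padicZ p_pr) R.
Implicit Types (xi : padicZ_dual p_pr) (sigma : padicZ p_pr -> int -> R[i]).

Local Notation normc := (@Normc.normc R).
Local Notation D b sigma x n := (vladimirov mu b (sigma ^~ n) x).

Lemma dual_absP xi : dual_abs xi = 0 \/ exists k, dual_abs xi = (p ^ k)%:Z.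
Proof.
rewrite /dual_abs; case: ifP => [_|_]; first by left.
rewrite /padic_abs; case: ifP => [_|_]; first by left; rewrite floor0.
have p0 : (0 < p%:R :> rat) by rewrite ltr0n prime_gt0.
case: (- padic_ord _) => k.
  by right; exists k; rewrite -exprnP -natrX pmulrn intrKfloor.
(* A negative exponent gives an absolute value in ]0, 1[, whose floor is 0. *)
left; apply/eqP; rewrite eq_le -ltzD1 add0r.
rewrite floor_ge0 floor_lt_int NegzE -exprnN invr_ge0 exprn_ge0// ?ltW// andbT.
by rewrite invf_lt1 ?exprn_gt0// exprn_egt1// ltr1n prime_gt1.
Qed.

Lemma japanese_ge1 xi : 1 <= japanese R xi.
Proof. by rewrite /japanese le_max lexx. Qed.

(** At xi = 0 the bracket is 1, so the symbol estimates for all a bound every difference at 0, and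
    these determine the values at all naturals. *)
Lemma symbol_class_pointwise_bound m rho delta sigma (b n : nat) :
  symbol_class mu m rho delta sigma ->
  exists B, forall x, normc (D b%:R sigma x n%:Z) <= B.
Proof.
move=> [_ sC]; move: n.
apply: (@iter_difference_nat_bound _ _ (fun x n => D b%:R sigma x n)) => a.
have [C aC] := sC a b; exists C => x; move: (aC x 0).
by rewrite /japanese /dual_abs eqxx (max_idPl ler01) powR1 mulr1 normc_le.
Qed.

(* The frequencies with |xi|_p < L take finitely many values, so there the
   pointwise bounds suffice. *)
Lemma symbol_class_of_large m rho delta sigma :
  (forall b n : nat, vladimirov_dom mu b%:R (fun x => sigma x n%:Z)) ->
  (forall b n : nat, exists B, forall x, normc (D b%:R sigma x n%:Z) <= B) ->
  (forall a b : nat, exists (L : nat) (C : R), forall x xi,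
    L%:Z <= dual_abs xi ->
    normc (iter a (@difference R) (fun n => D b%:R sigma x n) (dual_abs xi))
    <= C * japanese R xi `^ (m - rho * a%:R + delta * b%:R)) ->
  symbol_class mu m rho delta sigma.
Proof.
move=> sdom sB sL; split=> // a b.
have [L [C LC]] := sL a b.
have [B nB] := choice (sB b).
set e := m - _ + _.
pose M := \sum_(n < (L + a).+1) `|B n|.
pose J : R := L.+1%:R.
have M0 : 0 <= M by exact: sumr_ge0.
have MB n : (n < (L + a).+1)%N -> forall x, normc (D b%:R sigma x n%:Z) <= M.
  move=> nLa x; apply: le_trans (nB n x) _; apply: le_trans (ler_norm _) _.
  rewrite /M (bigD1 (Ordinal nLa))//= lerDl; exact: sumr_ge0.
(* The first summand serves |xi|_p >= L. Below L, [M] bounds all values met by the a-th difference,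
   and [J] to the power |e| compensates a possible decay: 1 <= <xi> <= J gives <xi>^e >=
   J^(-|e|). *)
exists (`|C| + 2 ^+ a * M * J `^ `|e|) => x xi; rewrite normc_le mulrDl.
have [Lxi|xiL] := leP L%:Z (dual_abs xi).
  apply: le_trans (LC x xi Lxi) _; apply: ler_wpDr.
    by rewrite !mulr_ge0 ?powR_ge0.
  by rewrite ler_wpM2r ?powR_ge0// ler_norm.
apply: ler_wpDl; first by rewrite mulr_ge0 ?powR_ge0.
have [l lE lL] : exists2 l : nat, dual_abs xi = l%:Z & (l < L)%N.
  have [|[k]] := dual_absP xi => E; [exists 0%N|exists (p ^ k)%N] => //;
    by rewrite -ltz_nat; move: xiL; rewrite E.
apply: (@le_trans _ _ (2 ^+ a * M)).
  rewrite lE; apply: iter_difference_bound => i ia; rewrite -PoszD.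
  by apply: MB; rewrite ltnS leq_add// ltnW.
rewrite -(mulrA _ (J `^ _)) ler_peMr ?mulr_ge0//.
have jJ : japanese R xi <= J.
  by rewrite /japanese lE ge_max ler1n ltn0Sn/= ler_nat leqW// ltnW.
have j1 := japanese_ge1 xi.
apply: (@le_trans _ _ (J `^ `|e| * J `^ (- `|e|))).
  rewrite -powRD ?subrr ?powRr0//.
  by rewrite implybE pnatr_eq0 orbT.
rewrite ler_pM2l ?powR_gt0 ?ltr0Sn//.
apply: (@le_trans _ _ (japanese R xi `^ (- `|e|))).
  rewrite !powRN lef_pV2 ?posrE ?powR_gt0 ?ltr0Sn ?(lt_le_trans ltr01)//.
  by rewrite ge0_ler_powR// nnegrE (le_trans ler01)// ?(le_trans j1).
by apply: ler_powR => //; rewrite lerNl ler_normr lexx orbT.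
Qed.
End Symbols.

(** * Choice of the cutoffs and asymptotic summation *)

(** The gap m_j - m_(j+1) is positive, so p^k raised to it eventually exceeds 2^(j+1) times the sum
    of the finitely many constants involved: one step in the order pays for the factor 2^-(j+1). The
    bound j <= K j keeps finitely many cutoffs below any n. *)
Lemma tail_cutoff_exists (R : realType) (p : nat) (m : nat -> R)
    (C : nat -> nat -> nat -> R) :
  (1 < p)%N -> (forall i j : nat, (i < j)%N -> m j < m i) ->
  exists K : nat -> nat, (forall j, (j <= K j)%N) /\
    forall j k a b, (a <= j.+1)%N -> (b <= j.+1)%N -> (K j.+1 <= k)%N ->
    forall e, C j.+1 a b * (p ^ k)%:R `^ (m j.+1 + e) <=
      2^-1 ^+ j.+1 * (p ^ k)%:R `^ (m j + e).
Proof.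
move=> p1 m_decr.
pose S j := \sum_(i < j.+1) \sum_(l < j.+1) `|C j i l|.
have S_ge j a b : (a <= j)%N -> (b <= j)%N -> C j a b <= S j.
  move=> aj bj; apply: le_trans (ler_norm _) _.
  have aj' : (a < j.+1)%N by []. have bj' : (b < j.+1)%N by [].
  rewrite /S (bigD1 (Ordinal aj'))//= (bigD1 (Ordinal bj'))//= -addrA lerDl.
  by rewrite addr_ge0// sumr_ge0// => i _; rewrite sumr_ge0.
(* The disjunct j = 0 covers the index without predecessor. *)
have /choice[K KP] : forall j, exists K : nat, (j <= K)%N /\
    forall k, (K <= k)%N -> 2 ^+ j * S j <= (p ^ k)%:R `^ (m j.-1 - m j) \/ j = 0%N.
  case=> [|j]; first by exists 0%N; split=> // k _; right.
  have d0 : 0 < m j - m j.+1 by rewrite subr_gt0 m_decr.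
  have [K KP] := powR_ge_eventually (2 ^+ j.+1 * S j.+1) p1 d0.
  exists (maxn j.+1 K); split=> [|k]; first exact: leq_maxl.
  by rewrite geq_max => /andP[_ /KP]; left.
exists K; split=> [j|j k a b aj bj Kk e]; first by have [] := KP j.
have [_ /(_ k Kk)[/= KS|//]] := KP j.+1.
set t := (p ^ k)%:R in KS *.
have t0 : 0 < t by rewrite ltr0n expn_gt0 ltnW.
have -> : m j + e = (m j - m j.+1) + (m j.+1 + e) by rewrite addrA subrK.
rewrite [in leRHS]powRD ?(gt_eqF t0) ?implybT// mulrA.
apply: ler_wpM2r; first exact: powR_ge0.
apply: le_trans (S_ge _ _ _ aj bj) _.
rewrite exprVn mulrC -ler_pdivrMr ?invr_gt0 ?exprn_gt0// invrK mulrC.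
exact: KS.
Qed.

Theorem theorem5p1 (R : realType) (p : nat) (p_pr : prime p)
    (mu : probability (padicZ p_pr) R) (mu_haar : is_haar mu)
    (rho delta : R) (delta_ge0 : 0 <= delta) (delta_lt_rho : delta < rho)
    (rho_le1 : rho <= 1)
    (m : nat -> R) (m_decr : forall i j : nat, (i < j)%N -> m j < m i)
    (m_lim : m j @[j --> \oo] --> -oo)
    (sigma_ : nat -> padicZ p_pr -> int -> R[i])
    (sigma_class : forall j, symbol_class mu (m j) rho delta (sigma_ j)) :
  exists sigma : padicZ p_pr -> int -> R[i],
    symbol_class mu (m 0%N) rho delta sigma /\
    forall N : nat, symbol_class mu (m N) rho delta
      (fun x n => sigma x n - \sum_(0 <= j < N) sigma_ j x n).
Proof.
pose D (b : nat) (s : padicZ p_pr -> int -> R[i]) x n :=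
  vladimirov mu b%:R (s ^~ n) x.
pose e (j a b : nat) : R := m j - rho * a%:R + delta * b%:R.
have sC j : exists C : nat -> nat -> R, forall a b x
    (xi : padicZ_dual p_pr),
    Normc.normc (iter a (@difference R) (D b (sigma_ j) x) (dual_abs xi)) <=
    C a b * japanese R xi `^ e j a b.
  have [_ sC] := sigma_class j.
  have aC a : exists C : nat -> R, forall b x
      (xi : padicZ_dual p_pr),
      Normc.normc (iter a (@difference R) (D b (sigma_ j) x) (dual_abs xi)) <=
      C b * japanese R xi `^ e j a b.
    have [C CP] := choice (sC a).
    by exists C => b x xi; move: (CP b x xi); rewrite normc_le.
  by have [C CP] := choice aC; exists C.
have [C CP] := choice sC.
have p1 := prime_gt1 p_pr.
have [K [Kge Ktail]] := tail_cutoff_exists C p1 m_decr.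
(* The range j <= |n| omits no active term: p^(K j) <= |n| forces j <= K j < p^(K j) <= |n|. *)
pose sigma x n := \sum_(0 <= j < `|n|.+1 | (p ^ K j <= `|n|)%N) sigma_ j x n.
have sdom (b : nat) j n : vladimirov_dom mu b%:R (fun x => sigma_ j x n%:Z).
  by have [sd _] := sigma_class j; exact: sd.
pose tau N x n := sigma x n - \sum_(0 <= j < N) sigma_ j x n.
(* The case N = 0 is the claim on [sigma] itself. *)
suff tauP N : symbol_class mu (m N) rho delta (tau N).
  exists sigma; split=> //; have := tauP 0%N; congr symbol_class.
  by apply/funext => x; apply/funext => n; rewrite /tau big_geq// subr0.
have tauD (b n : nat) :
    vladimirov_dom mu b%:R (fun x => tau N x n%:Z) /\
    forall x, D b (tau N) x n%:Z =
      \sum_(0 <= j < n.+1 | (p ^ K j <= n)%N) D b (sigma_ j) x n%:Z -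
      \sum_(0 <= j < N) D b (sigma_ j) x n%:Z.
  have [d1 v1] := vladimirov_sum (index_iota 0 n.+1) (fun j => p ^ K j <= n)%N
    (fun j => sdom b j n).
  have [d2 v2] := vladimirov_sum (index_iota 0 N) xpredT (fun j => sdom b j n).
  split=> [|x]; first exact: (vladimirov_domB d1 d2).
  by rewrite -v1 -v2; exact: (vladimirovB x d1 d2).
apply: symbol_class_of_large => [b n|b n|a b].
- by have [] := tauD b n.
- have jB j := symbol_class_pointwise_bound b n (sigma_class j).
  have [B BP] := choice jB.
  exists (\sum_(0 <= j < n.+1 | (p ^ K j <= n)%N) B j + \sum_(0 <= j < N) B j).
  move=> x; have [_ tE] := tauD b n; rewrite [X in Normc.normc X]tE.
  apply: le_trans (le_normcD _ _) _; rewrite normcN.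
  apply: lerD; apply: (le_trans (normc_sum _ _ _)).
  - by apply: ler_sum => j _; exact: BP.
  - by apply: ler_sum => j _; exact: BP.
(* A cutoff p^(K j) in ]p^k, p^k + a] is excluded by a < p^k, because the next
   power of p is at least 2 p^k. *)
pose L := (a.+1 + N + \sum_(0 <= j < N) p ^ K j)%N.
(* From J on the tail estimate applies: a, b <= j, and N < j gives m_(j-1) <= m_N. Beyond L the
   first N cutoffs have been passed and p^k > a. *)
pose J := (maxn N.+1 (maxn a b)).
have [B BP] := sum_geometric_tail_bounded J (fun j => C j a b).
exists L, B => x xi Lxi.
have [k xiE] : exists k, dual_abs xi = (p ^ k)%:Z.
  by have [xi0|//] := dual_absP xi; move: Lxi; rewrite xi0.
move: Lxi; rewrite xiE lez_nat => Lk.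
have ak : (a < p ^ k)%N by apply: leq_trans Lk; rewrite /L -addnA leq_addr.
have Nk : (N <= p ^ k)%N.
  by apply: leq_trans Lk; rewrite /L addnAC leq_addl.
have Kk j : (j < N)%N -> (p ^ K j <= p ^ k)%N.
  move=> jN; apply: leq_trans Lk; rewrite /L big_mkord (bigD1 (Ordinal jN))//=.
  by rewrite addnCA leq_addr.
have japE : japanese R xi = (p ^ k)%:R.
  by rewrite /japanese xiE; apply/max_idPr; rewrite ler1n expn_gt0 prime_gt0.
have cutoffE i j : (i <= a)%N ->
    (p ^ K j <= p ^ k + i)%N = (p ^ K j <= p ^ k)%N.
  move=> ia; apply/idP/idP => [|h]; last exact: (leq_trans h (leq_addr _ _)).
  rewrite !(leq_exp2l _ _ p1); apply: contraTT; rewrite -!ltnNge => kK.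
  apply: (@leq_trans (p ^ k.+1)); last by rewrite leq_exp2l.
  rewrite expnS; apply: (@leq_trans (2 * p ^ k)); last by rewrite leq_mul2r p1 orbT.
  by rewrite mul2n -addnn ltn_add2l (leq_ltn_trans ia).
(* On the window p^k, ..., p^k + a the first N terms are all active and cancel the subtracted sum,
   leaving an index set independent of n. *)
rewrite (@iter_difference_eq _ _ _ (fun n =>
    \sum_(N <= j < p ^ k | (p ^ K j <= p ^ k)%N) D b (sigma_ j) x n)); last first.
  move=> i ia; rewrite -PoszD; have [_ tE] := tauD b (p ^ k + i)%N.
  rewrite [LHS]tE; apply/eqP; rewrite subr_eq; apply/eqP.
  under eq_bigl do rewrite cutoffE//.
  have kk : (p ^ k <= (p ^ k + i).+1)%N by rewrite leqW// leq_addr.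
  (* Indices j >= p^k are inactive, since j <= K j < p^(K j). *)
  rewrite (@big_cat_nat _ _ _ (p ^ k))//= [X in _ + X]big1_seq ?addr0; last first.
    move=> j /andP[jk]; rewrite mem_index_iota => /andP[kj _].
    have := leq_trans (ltn_expl (K j) p1) jk.
    by move=> /(leq_ltn_trans (Kge j)); rewrite ltnNge kj.
  rewrite (@big_cat_nat _ _ _ N)//= addrC; congr (_ + _).
  rewrite big_nat_cond [RHS]big_nat_cond; apply: eq_bigl => j.
  by case: (ltnP j N) => jN; rewrite ?andbF// Kk.
rewrite iter_difference_sum; apply: le_trans (normc_sum _ _ _) _.
pose A j : R := if (j < J)%N then `|C j a b| else 2^-1 ^+ j.
have A0 j : 0 <= A j by rewrite /A; case: ifP => // _; rewrite exprn_ge0.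
apply: (@le_trans _ _
    (\sum_(N <= j < p ^ k | (p ^ K j <= p ^ k)%N) A j * japanese R xi `^ e N a b)).
  rewrite big_nat_cond [leRHS]big_nat_cond; apply: ler_sum => j.
  move=> /andP[/andP[Nj _] jk].
  have := CP j a b x xi; rewrite xiE => /le_trans; apply.
  have mle i : (N <= i)%N -> e i a b <= e N a b.
    rewrite leq_eqVlt => /predU1P[->//|/m_decr/ltW mi].
    by rewrite /e lerD2r lerD2r.
  have jle i : (N <= i)%N -> japanese R xi `^ e i a b <= japanese R xi `^ e N a b.
    by move=> /mle; apply: ler_powR; exact: japanese_ge1.
  (* For j < J the estimate of [sigma_ j] itself is used, with m_j <= m_N. *)
  rewrite /A; case: ltnP => [jJ|].
    apply: (@le_trans _ _ (`|C j a b| * japanese R xi `^ e j a b)).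
      by rewrite ler_wpM2r ?powR_ge0// ler_norm.
    by rewrite ler_wpM2l// jle.
  rewrite /J !geq_max => /and3P[Nj' aj bj].
  (* Here j > N >= 0 is a successor; its predecessor is still at least N, so the order lost to the
     tail estimate stays below m_N. *)
  case: j {Nj} => // j in jk Nj' aj bj *.
  apply: (@le_trans _ _ (2^-1 ^+ j.+1 * japanese R xi `^ e j a b)).
    rewrite japE /e -!addrA; apply: Ktail => //; by rewrite -(leq_exp2l _ _ p1).
  by rewrite ler_wpM2l ?exprn_ge0// jle.
rewrite -mulr_suml ler_wpM2r ?powR_ge0//.
have BPA : \sum_(0 <= j < p ^ k) A j <= B by exact: BP.
apply: le_trans BPA.
rewrite [leRHS](@big_cat_nat _ _ _ N)//= -[leLHS]add0r.
apply: lerD; first exact: sumr_ge0.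
by rewrite big_mkcond/=; apply: ler_sum => j _; case: ifP.
Qed.
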